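(* Let $S$ be a numerical semigroup with multiplicity $m$ and genus $g$. Then $$2^{m-1}+g-m+1\le |\mathcal{C}\ell(S)|.$$
   Context: $\mathbb{N}$ denotes the non-negative integers. A numerical semigroup $S$ is a submonoid of $(\mathbb{N},+)$ with finite complement in $\mathbb{N}$. The multiplicity of $S$ is its smallest positive element, and the genus of $S$ is $|\mathbb{N}\setminus S|$. An ideal of $S$ is a non-empty set $E\subseteq\mathbb{Z}$ with $S+E\subseteq E$ and such that $s+E\subseteq S$ for some $s\in S$. The set $\mathcal{I}(S)$ of ideals of $S$ is a commutative monoid under $I+J=\{i+j: i\in I, j\in J\}$, with identity $S$. Define the congruence $I\sim J$ if $I=z+J$ for some $z\in\mathbb{Z}$. The ideal class monoid is $\mathcal{C}\ell(S)=\mathcal{I}(S)/\sim$. *)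

(* Defs.v *)
From mathcomp Require Import all_boot all_order all_algebra.
From mathcomp Require Import finmap.
From mathcomp Require Import boolp classical_sets functions cardinality.

Set Implicit Arguments.
Unset Strict Implicit.
Unset Printing Implicit Defensive.

Import GRing.Theory Num.Theory.
Local Open Scope classical_set_scope.

Definition numerical_semigroup (S : set nat) : Prop :=
  [/\ S 0%N,
      forall x y : nat, S x -> S y -> S (x + y)%N
    & finite_set (~` S)].

Definition is_multiplicity (S : set nat) (m : nat) : Prop :=
  [/\ S m, (0 < m)%N & forall n : nat, S n -> (0 < n)%N -> (m <= n)%N].

(* [fset_set A] is the finite set with the elements of [A] if [A] is finite,
   and the empty set otherwise; the complement of a numerical semigroup is
   finite by definition. *)
Definition genus (S : set nat) : nat := #|` fset_set (~` S)|%fset.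

Definition set_add (A B : set int) : set int :=
  [set (a + b)%R | a in A & b in B].

Definition translate (z : int) (A : set int) : set int :=
  [set (z + a)%R | a in A].

Definition ideals (S : set nat) : set (set int) :=
  [set E | [/\ E !=set0,
               set_add (Posz @` S) E `<=` E
             & exists2 s : nat, S s & translate s%:Z E `<=` Posz @` S]].

Definition ideal_equiv (I J : set int) : Prop :=
  exists z : int, I = translate z J.

Definition ideal_class (S : set nat) (I : set int) : set (set int) :=
  [set J | ideals S J /\ ideal_equiv I J].

(* The underlying set of the monoid: the quotient of [ideals S] by
   [ideal_equiv], as a set of equivalence classes.  It is finite when [S] is a
   numerical semigroup, since each class has a representative lying between [S]
   and the non-negative integers. *)
Definition ideal_class_monoid (S : set nat) : set (set (set int)) :=
  ideal_class S @` ideals S.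

Lemma ideal_equiv_refl (I : set int) : ideal_equiv I I.
Proof.
exists 0%R; apply/seteqP; split => [x Ix|_ [x Ix <-]]; last by rewrite add0r.
by exists x => //; rewrite add0r.
Qed.

Lemma ideal_equiv_sym (I J : set int) : ideal_equiv I J -> ideal_equiv J I.
Proof.
move=> [z ->]; exists (- z)%R; apply/seteqP; split => [x Jx|_ [_ [x Jx <-] <-]].
  by exists (z + x)%R; [exists x|rewrite addKr].
by rewrite addKr.
Qed.

Lemma ideal_equiv_trans (I J K : set int) :
  ideal_equiv I J -> ideal_equiv J K -> ideal_equiv I K.
Proof.
move=> [z ->] [w ->]; exists (z + w)%R.
apply/seteqP; split => [_ [_ [x Kx <-] <-]|_ [x Kx <-]].
  by exists x => //; rewrite addrA.
by exists (w + x)%R; [exists x|rewrite addrA].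
Qed.

Lemma ideal_equiv_add (I I' J J' : set int) : ideal_equiv I I' ->
  ideal_equiv J J' -> ideal_equiv (set_add I J) (set_add I' J').
Proof.
move=> [z ->] [w ->]; exists (z + w)%R.
apply/seteqP; split => [_ [_ [i Ii <-] [_ [j Jj <-] <-]]|_ [_ [i Ii [j Jj <-]] <-]].
  by exists (i + j)%R; [exists i => //; exists j|rewrite addrACA].
by exists (z + i)%R; [exists i|exists (w + j)%R; [exists j|rewrite addrACA]].
Qed.

(* Main.v *)
(** Every class has a representative [E] with minimum [0], so [S] is contained
    in [E] and [E] is the union of [S] and a set [A] of gaps; distinct [A] give
    distinct classes.  The union is an ideal when [A] consists of all the gaps
    above [m] and of an arbitrary subset of [{1, ..., m - 1}], which makes
    [2 ^ (m - 1)] classes.  Each of the [g - (m - 1)] gaps [x] above [m] yields one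
    more, whose [A] misses [x]: the set of the gaps larger than [x]. *)
Require Import Defs.
From mathcomp Require Import all_boot all_order all_algebra.
From mathcomp Require Import finmap.
From mathcomp Require Import boolp classical_sets functions cardinality.
From mathcomp Require Import zify.

Import GRing.Theory.
Local Open Scope classical_set_scope.

Definition gap_extension (S : set nat) (A : {fset nat}) : set nat :=
  S `|` [set` A].

Definition gap_class (S : set nat) (A : {fset nat}) : set (set int) :=
  ideal_class S (Posz @` gap_extension S A).

Lemma conductor_exists (S : set nat) :
  numerical_semigroup S -> exists2 c, S c & forall n, (c <= n)%N -> S n.
Proof.
move=> [_ _ finG].
have Sbig n : (\max_(x <- fset_set (~` S)) x < n)%N -> S n.
  move=> lt_n; apply: contrapT => gap_n; move: lt_n; rewrite ltnNge.
  by rewrite (@leq_bigmax_seq _ _ predT id) // in_fset_set // inE.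
by exists (\max_(x <- fset_set (~` S)) x).+1 => [|n /Sbig //]; apply: Sbig.
Qed.

(** Since [T] has no negative elements, shifting it by a bound [c] beyond which there are no gaps
    puts it inside [S]. *)
Lemma nat_set_ideal (S T : set nat) : numerical_semigroup S -> T !=set0 ->
  (forall s t, S s -> T t -> T (s + t)%N) -> ideals S (Posz @` T).
Proof.
move=> hS [t Tt] closedT; split.
- by exists (Posz t), t.
- by move=> _ [_ [s Ss <-] [_ [u Tu <-] <-]]; exists (s + u)%N; [apply: closedT|].
- have [c Sc Sbig] := conductor_exists _ hS; exists c => //.
  move=> _ [_ [u Tu <-] <-]; exists (c + u)%N => //.
  by apply: Sbig; rewrite leq_addr.
Qed.

Lemma ideal_class_eq (S : set nat) (I J : set int) :
  ideal_equiv I J -> ideal_class S I = ideal_class S J.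
Proof.
move=> IJ; apply/seteqP; split=> K [SK eqK]; split=> //.
  exact: ideal_equiv_trans (ideal_equiv_sym IJ) eqK.
exact: ideal_equiv_trans IJ eqK.
Qed.

(** Both sets have minimum [0], and a translation carries minimum to minimum, so the shift [z]
    vanishes. *)
Lemma ideal_equiv_nat_set (T U : set nat) : T 0%N -> U 0%N ->
  ideal_equiv (Posz @` T) (Posz @` U) -> T = U.
Proof.
move=> T0 U0 [z eqTU].
have [_ [u _ <-] zu0] : translate z (Posz @` U) 0%R by rewrite -eqTU; exists 0%N.
have [t _ tz] : (Posz @` T) z.
  by rewrite eqTU; exists 0%R; [exists 0%N|rewrite addr0].
have z0 : z = 0%R by lia.
apply/seteqP; split=> x Xx.
  have : (Posz @` T) (Posz x) by exists x.
  by rewrite eqTU z0 => -[_ [y Uy <-]]; rewrite add0r => -[<-].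
have : translate z (Posz @` U) (Posz x).
  by exists (Posz x); [exists x|rewrite z0 add0r].
by rewrite -eqTU => -[y Ty [<-]].
Qed.

Lemma ideal_class_nat_set_inj (S T U : set nat) :
    T 0%N -> U 0%N -> ideals S (Posz @` T) ->
  ideal_class S (Posz @` T) = ideal_class S (Posz @` U) -> T = U.
Proof.
move=> T0 U0 idT eqC; apply/esym/ideal_equiv_nat_set => //.
have : ideal_class S (Posz @` T) (Posz @` T).
  by split=> //; apply: ideal_equiv_refl.
by rewrite eqC => -[].
Qed.

Lemma ideal_normal_form (S : set nat) (E : set int) :
    ideals S E -> exists T : set nat,
  [/\ T 0%N, forall s t, S s -> T t -> T (s + t)%N & ideal_equiv E (Posz @` T)].
Proof.
move=> [[e Ee] closedE [s Ss sE]].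
have inN x : E x -> exists n, (s%:Z + x = n%:Z)%R.
  by move=> Ex; have [n _ <-] := sE _ (imageP _ Ex); exists n.
have [n0 n0E] := inN e Ee.
(* The minimum is taken in [s + E], which consists of natural numbers; if it is [n], then [n - s] is
   the minimum of [E], and translating it to [0] gives [T]. *)
have exP : exists n, `[< E (n%:Z - s%:Z)%R >].
  by exists n0; apply/asboolP; rewrite -n0E addrC addKr.
case: (ex_minnP exP) => n /asboolP En min_n.
exists [set k | E (k%:Z + (n%:Z - s%:Z))%R]; split=> /=.
- by rewrite add0r.
- move=> u t Su Et; apply: closedE; exists (Posz u); first by exists u.
  by exists (t%:Z + (n%:Z - s%:Z))%R => //; lia.
exists (n%:Z - s%:Z)%R; apply/seteqP; split=> [x Ex|_ [_ [k Ek <-] <-]]; last first.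
  by rewrite addrC.
have [k xk] := inN x Ex.
have le_nk : (n <= k)%N.
  by apply: min_n; apply/asboolP; rewrite -xk addrC addKr.
exists (Posz (k - n)); last by lia.
by exists (k - n)%N => //=; rewrite (_ : _ + _ = x)%R //; lia.
Qed.

(** By the normal form, the finitely many sets of gaps reach every class. Finiteness matters for the
    count, as [fset_set] is empty on infinite sets. *)
Lemma finite_ideal_class_monoid (S : set nat) :
  numerical_semigroup S -> finite_set (ideal_class_monoid S).
Proof.
move=> [S0 addS finG].
apply: (@sub_finite_set _ _
    (gap_class S @` [set` fpowerset (fset_set (~` S))])); last first.
  exact: finite_image.
move=> _ [E idE <-]; have [T [T0 closedT eqET]] := ideal_normal_form _ _ idE.
have finTS : finite_set (T `\` S) by apply: sub_finite_set finG => x [].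
exists (fset_set (T `\` S)).
  rewrite /= fpowersetE; apply/fsubsetP => x.
  by rewrite !in_fset_set // !inE => -[].
rewrite /gap_class /gap_extension fset_setK //.
rewrite (ideal_class_eq _ _ _ eqET) setDUK // => x Sx.
by rewrite -[x]addn0; apply: closedT.
Qed.

(** The class determines its representative with minimum [0], and removing [S] from that leaves
    [A]. *)
Lemma gap_class_inj (S : set nat) (A B : {fset nat}) :
    S 0%N -> (A `<=` fset_set (~` S))%fset -> (B `<=` fset_set (~` S))%fset ->
    finite_set (~` S) -> ideals S (Posz @` gap_extension S A) ->
  gap_class S A = gap_class S B -> A = B.
Proof.
move=> S0 /fsubsetP AG /fsubsetP BG finG idA eqAB.
have eqT : gap_extension S A = gap_extension S B.
  by apply: ideal_class_nat_set_inj idA eqAB; left.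
have gapP x : x \in fset_set (~` S) -> ~ S x by rewrite in_fset_set // inE.
apply/fsetP => x; apply/idP/idP => xX.
  have : gap_extension S A x by right.
  by rewrite eqT => -[/(gapP _ (AG _ xX))|].
have : gap_extension S B x by right.
by rewrite -eqT => -[/(gapP _ (BG _ xX))|].
Qed.

(** This reduces the lower bound to exhibiting many sets of gaps [A] for which the union of [S] and
    [A] is stable under adding [S]. *)
Lemma leq_card_ideal_class_monoid (S : set nat) (F : {fset {fset nat}}) :
    numerical_semigroup S ->
    (forall A, A \in F -> (A `<=` fset_set (~` S))%fset) ->
    (forall A s t, A \in F -> S s -> t \in A -> gap_extension S A (s + t)%N) ->
  (#|` F| <= #|` fset_set (ideal_class_monoid S)|)%N.
Proof.
move=> hS FG closedF; have [S0 addS finG] := hS.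
have idF A : A \in F -> ideals S (Posz @` gap_extension S A).
  move=> FA; apply: nat_set_ideal => // [|s t Ss [St|At]].
  - by exists 0%N; left.
  - by left; apply: addS.
  - exact: closedF.
rewrite -(card_in_imfset imfset_key (f := gap_class S) (p := mem F)) /=; last first.
  by move=> A B FA FB; apply: gap_class_inj => //; [exact: FG|exact: FG|exact: idF].
apply/fsubset_leq_card/fsubsetP => _ /imfsetP[A /= FA ->].
rewrite in_fset_set; last exact: finite_ideal_class_monoid.
by rewrite inE; exists (Posz @` gap_extension S A) => //; apply: idF.
Qed.

Theorem proposition3p8 (S : set nat) (m g : nat)
  (hS : numerical_semigroup S)
  (hm : is_multiplicity S m)
  (hg : genus S = g) :
  (2 ^+ (m - 1)%N + g%:Z - m%:Z + 1 <=
     #|` fset_set (ideal_class_monoid S)|%fset%:Z :> int)%R.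
Proof.
have [S0 addS finG] := hS; have [Sm m_gt0 min_m] := hm.
pose G := fset_set (~` S).
pose L := [fset x in iota 1 m.-1]%fset.
pose H := (G `\` L)%fset.
have inG x : reflect (~ S x) (x \in G).
  by rewrite in_fset_set //; apply: (iffP idP); rewrite inE.
have inL x : (x \in L) = (0 < x < m)%N.
  by rewrite inE /= mem_iota; lia.
have LG : (L `<=` G)%fset.
  apply/fsubsetP => x; rewrite inL => /andP[x_gt0 lt_xm].
  by apply/inG => /min_m /(_ x_gt0); rewrite leqNgt lt_xm.
have cardL : #|` L| = m.-1.
  by rewrite card_fseq undup_id ?iota_uniq // size_iota.
have HG : (H `<=` G)%fset by apply: fsubsetDl.
pose tail x := [fset y in G | (x < y)%N]%fset.
pose F1 := [fset (H `|` B)%fset | B in fpowerset L]%fset.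
pose F2 := [fset tail x | x in H]%fset.
(* [H] and [L] are disjoint, so [B] is the trace of its union with [H] on [L]. *)
have cardF1 : #|` F1| = (2 ^ m.-1)%N.
  rewrite card_in_imfset /= ?card_fpowerset ?cardL // => B C.
  rewrite !fpowersetE => /fsubsetP BL /fsubsetP CL /fsetP eqBC.
  apply/fsetP => x; have := eqBC x; rewrite !in_fsetU in_fsetD.
  case xL: (x \in L) => //= _.
  by rewrite (contraFF (BL x) xL) (contraFF (CL x) xL).
(* The map [tail] is injective: if [x < y], then [y] lies in [tail x] but not in [tail y]. Hence
   [F2] has as many elements as [H], the complement of [L] in [G]. *)
have cardF2 : (#|` F2| + m.-1 = g)%N.
  have tail_le x y : x \in H -> y \in H -> tail x = tail y -> (y <= x)%N.
    move=> Hx Hy eqxy; rewrite leqNgt; apply/negP => lt_xy.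
    have : y \in tail x by rewrite !inE (fsubsetP HG) //= lt_xy.
    by rewrite eqxy !inE ltnn andbF.
  rewrite card_in_imfset /= => [|x y Hx Hy eqxy]; last first.
    by apply/eqP; rewrite eqn_leq !tail_le.
  by rewrite -hg /genus -/G -cardL -(cardfsID L G) (fsetIidPr LG) addnC.
have disjF : (F1 `&` F2 = fset0)%fset.
  apply/fsetP => A; rewrite in_fsetI in_fset0; apply/negP.
  move=> /andP[/imfsetP[B /= _ ->] /imfsetP[x /= Hx /fsetP /(_ x)]].
  by rewrite in_fsetU Hx !inE ltnn andbF.
have cardF : (#|` (F1 `|` F2)%fset| = 2 ^ m.-1 + #|` F2|)%N.
  by rewrite cardfsU disjF cardfs0 subn0 cardF1.
have le_card : (#|` (F1 `|` F2)%fset| <= #|` fset_set (ideal_class_monoid S)|)%N.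
  apply: leq_card_ideal_class_monoid => // [A|A s t].
    rewrite in_fsetU => /orP[] /imfsetP[B /= + ->].
      rewrite fpowersetE => BL; rewrite fsubUset HG /=.
      exact: fsubset_trans BL LG.
    by move=> _; apply/fsubsetP => x; rewrite !inE => /andP[].
  (* A non-zero [s] is at least [m], so [s + t], if it is a gap, lies in [H], which settles [F1].
     For [F2], it exceeds [t], so it stays in the tail. *)
  move=> FA Ss tA; have [->|s_gt0] := posnP s; first by right.
  have le_ms := min_m _ Ss s_gt0.
  apply: contrapT => /not_orP[/= nS nA]; apply: nA; move: FA tA.
  rewrite in_fsetU => /orP[] /imfsetP[B /= + ->].
    by move=> _ _; rewrite in_fsetU in_fsetD inL; have /inG -> := nS; lia.
  by move=> _; rewrite !inE => /andP[_ lt_Bt]; have /inG -> := nS; lia.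
(* With the power moved to the natural numbers, the rest is linear; [m > 0] makes [m.-1] agree with
   the integer [m - 1]. *)
have -> : (2 ^+ (m - 1)%N = Posz (2 ^ m.-1) :> int)%R.
  by rewrite subn1 -natrX natz.
by move: le_card; rewrite cardF; lia.
Qed.
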